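(* For positive integers $m,n$ with $n>m+1$, $$\sum_{k=1}^n (-1)^{k-1}\left[\begin{matrix}2n\\ n-k\end{matrix}\right]k^{1+2m} = \frac18\sum_{\ell=0}^m (-1)^\ell \left\langle 2n-\tfrac12\right\rangle_{2\ell}\left\{\frac{2n-2\ell-1}{n-\ell-1}\left[\begin{matrix}2n-2\ell\\ n-\ell\end{matrix}\right] + (-1)^{n+\ell}\frac{(1+2n)(1+2\ell)}{n-\ell-1}\left[\begin{matrix}2n-\ell\\ \ell\end{matrix}\right]^{-1}\right\}\sigma_{m,\ell}\left(n-\tfrac12\right).$$
   Context: Rising factorial: $(x)_0=1$, $(x)_j=x(x+1)\cdots(x+j-1)$; falling factorial: $\langle x\rangle_0=1$, $\langle x\rangle_j=x(x-1)\cdots(x-j+1)$ for positive integers $j$. For integers $0\le j\le N$, $\left[\begin{matrix}N\\ j\end{matrix}\right]=\frac{(\frac12)_N}{(\frac12)_j(\frac12)_{N-j}}$. For nonnegative integers $\ell\le m$ and an indeterminate $y$, $\sigma_{m,\ell}(y)$ denotes the coefficient of $T^{m-\ell}$ in the formal power series $\prod_{j=0}^{\ell} \frac{1}{1-T(y-j)^2}$; equivalently $\sigma_{m,\ell}(y)=\sum_{0\le k_1\le\cdots\le k_{m-\ell}\le \ell}\prod_{i=1}^{m-\ell}(y-k_i)^2$. *)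

(* Defs.v *)
From mathcomp Require Import all_boot all_order all_algebra.

Set Implicit Arguments.
Unset Strict Implicit.
Unset Printing Implicit Defensive.

Import GRing.Theory.
Local Open Scope ring_scope.

Definition rising (R : comNzRingType) (x : R) (j : nat) : R :=
  \prod_(i < j) (x + i%:R).

Definition falling (R : comNzRingType) (x : R) (j : nat) : R :=
  \prod_(i < j) (x - i%:R).

(* Half-integer binomial (1/2)_N / ((1/2)_j (1/2)_(N-j)), meaningful only for
   j <= N because N - j is truncated. *)
Definition hbin (N j : nat) : rat :=
  rising (2^-1 : rat) N / (rising (2^-1 : rat) j * rising (2^-1 : rat) (N - j)).

(* A formal power series in T over R is the sequence of its coefficients. *)
Definition fps (R : comNzRingType) : Type := nat -> R.

Definition fps_of_poly (R : comNzRingType) (p : {poly R}) : fps R :=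
  fun d => p`_d.

Definition fps_one (R : comNzRingType) : fps R := fun d => (d == 0%N)%:R.

Definition fps_mul (R : comNzRingType) (a b : fps R) : fps R :=
  fun d => \sum_(i < d.+1) a i * b (d - i)%N.

(* 1 / (1 - c T); see fps_geomP. *)
Definition fps_geom (R : comNzRingType) (c : R) : fps R := fun d => c ^+ d.

Lemma fps_geomP (R : comNzRingType) (c : R) :
  fps_mul (fps_of_poly (1 - c *: 'X)) (fps_geom c) =1 @fps_one R.
Proof.
move=> d; rewrite /fps_mul /fps_of_poly /fps_geom /fps_one.
under eq_bigr => i _ do rewrite coefB coef1 coefZ coefX.
case: d => [|d]; first by rewrite big_ord1 mulr0 subr0 mul1r.
rewrite 2!big_ord_recl big1 /= => [|i _]; last by rewrite mulr0 subr0 mul0r.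
by rewrite mulr0 subr0 mul1r mulr1 sub0r addr0 subn0 subSS subn0 exprS mulNr subrr.
Qed.

(* Coefficient of T^(m-l) in \prod_(j = 0..l) 1 / (1 - T (y - j)^2), for
   l <= m. *)
Definition sigma (R : comNzRingType) (m l : nat) (y : R) : R :=
  (\big[@fps_mul R/@fps_one R]_(j < l.+1) fps_geom ((y - j%:R) ^+ 2)) (m - l)%N.

(* Main.v *)
(* Newton interpolation of x^m at the nodes (n - 1/2 - j)^2, evaluated at
   x = k^2, turns k^(2m) into the combination of the products
   \prod_(j < l) (k^2 - (n - 1/2 - j)^2) with coefficients sigma m l (n - 1/2).
   Such a product absorbs l factors of each of the two denominators of
   hbin (2n) (n - k), and the remaining alternating sum over k, weighted by k,
   telescopes in closed form.  Its two boundary terms are the two summands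
   inside the braces. *)
Require Import Defs.
From mathcomp Require Import all_boot all_order all_algebra.
From mathcomp Require Import ring lra zify.

Set Implicit Arguments.
Unset Strict Implicit.
Unset Printing Implicit Defensive.

Import Order.TTheory GRing.Theory Num.Theory.
Local Open Scope ring_scope.

(** Its coefficients are the complete homogeneous symmetric polynomials in the first [l] nodes;
    [sigma] is the case of squared half-integer-shifted nodes. *)
Definition geom_prod (R : comNzRingType) (c : nat -> R) (l : nat) : fps R :=
  \big[@fps_mul R/@fps_one R]_(j < l) fps_geom (c j).

Lemma geom_prod_recl (R : comNzRingType) (c : nat -> R) l :
  geom_prod c l.+1 = fps_mul (fps_geom (c 0%N)) (geom_prod (fun j => c j.+1) l).
Proof. by rewrite /geom_prod big_ord_recl. Qed.

Lemma geom_prod0 (R : comNzRingType) (c : nat -> R) l : geom_prod c l 0%N = 1.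
Proof.
elim: l c => [|l IHl] c; first by rewrite /geom_prod big_ord0.
by rewrite geom_prod_recl /fps_mul big_ord1 IHl mulr1.
Qed.

(** Coefficient form of 1/(1 - c_0 T) = 1 + c_0 T/(1 - c_0 T). *)
Lemma geom_prodSS (R : comNzRingType) (c : nat -> R) l d :
  geom_prod c l.+1 d.+1
  = c 0%N * geom_prod c l.+1 d + geom_prod (fun j => c j.+1) l d.+1.
Proof.
rewrite geom_prod_recl /fps_mul big_ord_recl /fps_geom expr0 mul1r subn0 addrC.
congr (_ + _); rewrite mulr_sumr; apply: eq_bigr => i _.
by rewrite subSS exprS mulrA.
Qed.

(** Induction through x^(m+1) = c_0 x^m + (x - c_0) x^m, expanding the first x^m at the nodes [c]
    and the second at the shifted nodes [c']. *)
Lemma newton_expansion (R : comNzRingType) (c : nat -> R) (x : R) m :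
  x ^+ m
  = \sum_(l < m.+1) geom_prod c l.+1 (m - l)%N * \prod_(j < l) (x - c j).
Proof.
elim: m c => [|m IHm] c.
  by rewrite big_ord1 big_ord0 geom_prod0 mulr1.
pose c' j := c j.+1.
have step (l : 'I_m.+1) :
    geom_prod c l.+1 (m.+1 - l)%N * \prod_(j < l) (x - c j)
    = c 0%N * (geom_prod c l.+1 (m - l)%N * \prod_(j < l) (x - c j))
      + geom_prod c' l (m.+1 - l)%N * \prod_(j < l) (x - c j).
  by rewrite subSn -1?ltnS ?ltn_ord // geom_prodSS mulrDl mulrA.
(* The [F l] must add up to (x - c_0) x^m. The top term is [F m.+1] because both coefficients are
   constant terms, equal to 1; [F 0] vanishes because the empty product has no T^(m+1). *)
pose F (l : nat) := geom_prod c' l (m.+1 - l)%N * \prod_(j < l) (x - c j).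
have lastE : geom_prod c m.+2 (m.+1 - m.+1)%N * \prod_(j < m.+1) (x - c j)
    = F m.+1 by rewrite /F subnn !geom_prod0.
have F0 : F 0%N = 0 by rewrite /F /geom_prod big_ord0 [fps_one _]/= mul0r.
rewrite big_ord_recr /= lastE (eq_bigr _ (fun l _ => step l)) big_split /=.
rewrite -mulr_sumr -IHm -addrA -[X in _ + X]/(\sum_(l < m.+1) F l + F m.+1).
rewrite -(big_ord_recr _ (fun l : 'I_m.+2 => F l)) big_ord_recl /=.
rewrite F0 add0r.
under eq_bigr => i _ do
  rewrite /F /bump /= add1n subSS big_ord_recl /= mulrCA.
by rewrite -mulr_sumr -(IHm c') -mulrDl addrC subrK exprS.
Qed.

Lemma risingS (R : comNzRingType) (x : R) j :
  rising x j.+1 = rising x j * (x + j%:R).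
Proof. by rewrite /rising big_ord_recr. Qed.

Lemma fallingS (R : comNzRingType) (x : R) j :
  falling x j.+1 = falling x j * (x - j%:R).
Proof. by rewrite /falling big_ord_recr. Qed.

Lemma falling_recl (R : comNzRingType) (x : R) j :
  falling x j.+1 = x * falling (x - 1) j.
Proof.
rewrite /falling big_ord_recl subr0; congr (_ * _).
apply: eq_bigr => i _; rewrite /= /bump /= natrD; ring.
Qed.

Lemma falling_opp (R : comNzRingType) (x : R) j :
  falling (- x) j = (-1) ^+ j * rising x j.
Proof.
elim: j => [|j IHj]; first by rewrite /falling /rising !big_ord0 mulr1.
by rewrite fallingS risingS IHj exprS; ring.
Qed.

Local Notation half_rising := (rising (2^-1 : rat)).

Lemma half_rising_neq0 j : half_rising j != 0.
Proof.
apply: lt0r_neq0; apply: prodr_gt0 => i _.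
by apply: ltr_wpDr; rewrite ?ler0n ?invr_gt0.
Qed.

(** The left side consists of the last [l] factors of (1/2)_N. *)
Lemma falling_half (N l : nat) : (l <= N)%N ->
  falling (N%:R - 2^-1 : rat) l = half_rising N / half_rising (N - l).
Proof.
elim: l => [|l IHl] le_lN.
  by rewrite subn0 divff ?half_rising_neq0 // /falling big_ord0.
rewrite fallingS IHl ?(ltnW le_lN) //.
have -> : (N - l = (N - l.+1).+1)%N by lia.
have eN : N%:R = (N - l.+1)%:R + l%:R + 1 :> rat.
  by rewrite -natrD natr1; congr (_%:R); lia.
have := half_rising_neq0 (N - l.+1).+1; rewrite risingS eN.
rewrite mulf_eq0 negb_or => /andP[h0 h1].
field; rewrite h0 /=; move: h1; apply: contra => /eqP h1.
by apply/eqP; lra.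
Qed.

Section Telescoping.

Variables n l : nat.

(* This is 1 / ((1/2)_(n-k-l) (1/2)_(n+k-l)); the falling factorials keep it
   meaningful when n - k < l. *)
Definition absorbed (k : nat) : rat :=
  falling (n%:R - k%:R - 2^-1) l * falling (n%:R + k%:R - 2^-1) l
  / (half_rising (n - k) * half_rising (n + k)).

(* Up to the factor -4 (n - l - 1), the Gosper antidifference of the alternating
   sequence (-1)^(k-1) k (absorbed k). *)
Definition boundary (k : nat) : rat :=
  (-1) ^+ k * (2 * k%:R + 1) * (n%:R - k%:R - 2^-1 - l%:R) * absorbed k.

(** For l < n - k both sides are 1/((1/2)_(n-k-l-1) (1/2)_(n+k-l)); arguing with falling factorials
    also covers n - k <= l. *)
Lemma absorbedS k : (k < n)%N ->
  absorbed k * (n%:R - k%:R - 2^-1 - l%:R)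
  = absorbed k.+1 * (n%:R + k.+1%:R - 2^-1 - l%:R).
Proof.
move=> lt_kn; rewrite /absorbed.
have -> : (n - k = (n - k.+1).+1)%N by lia.
rewrite addnS !risingS.
(* [p] and [q] are the last factors of (1/2)_(n-k) and (1/2)_(n+k+1). *)
set p : rat := n%:R - k%:R - 2^-1; set q : rat := n%:R + k.+1%:R - 2^-1.
have -> : n%:R - k.+1%:R - 2^-1 = p - 1 :> rat by rewrite /p -natr1; ring.
have -> : n%:R + k%:R - 2^-1 = q - 1 :> rat by rewrite /q -natr1; ring.
have -> : 2^-1 + (n - k.+1)%:R = p by rewrite /p natrB // -natr1; field.
have -> : 2^-1 + (n + k)%:R = q by rewrite /q natrD -natr1; field.
have p0 : p != 0.
  apply: lt0r_neq0; rewrite /p.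
  have : k.+1%:R <= n%:R :> rat by rewrite ler_nat.
  by rewrite -natr1; lra.
have q0 : q != 0.
  apply: lt0r_neq0; rewrite /q -natr1.
  have := ler0n rat n; have := ler0n rat k; lra.
have ep : falling p l * (p - l%:R) = p * falling (p - 1) l.
  by rewrite -fallingS falling_recl.
have eq : falling q l * (q - l%:R) = q * falling (q - 1) l.
  by rewrite -fallingS falling_recl.
transitivity ((falling p l * (p - l%:R)) * falling (q - 1) l
   / (half_rising (n - k.+1) * p * half_rising (n + k))).
  by rewrite !invfM; ring.
transitivity (falling (p - 1) l * (falling q l * (q - l%:R))
   / (half_rising (n - k.+1) * (half_rising (n + k) * q))); last first.
  by rewrite !invfM; ring.
rewrite ep eq; field.
by rewrite p0 q0 !half_rising_neq0.
Qed.

(** By [absorbedS] both boundary terms of a step are multiples of [absorbed k.+1], and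
    (2k+1)(n-l+k+1/2) + (2k+3)(n-l-k-3/2) = 4(k+1)(n-l-1). *)
Lemma telescoping k : (k <= n)%N ->
  4 * (n%:R - l%:R - 1)
    * (\sum_(1 <= i < k.+1) (-1) ^+ (i - 1) * i%:R * absorbed i)
  = boundary 0 - boundary k.
Proof.
elim: k => [|k IHk] le_kn; first by rewrite big_geq // mulr0 subrr.
rewrite big_nat_recr //= mulrDr IHk ?(ltnW le_kn) //.
rewrite subSS subn0 /boundary -!mulrA.
rewrite [(n%:R - k%:R - 2^-1 - l%:R) * _]mulrC absorbedS //.
by rewrite exprS -[k.+1%:R]natr1; field.
Qed.

End Telescoping.

Lemma hbin_neq0 N j : hbin N j != 0.
Proof. by rewrite /hbin !(mulf_neq0, invr_neq0) ?half_rising_neq0. Qed.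

(** Each difference of squares splits as -(n-k-1/2-j)(n+k-1/2-j). *)
Lemma prod_newton_nodes (n k l : nat) :
  \prod_(j < l) (k%:R ^+ 2 - (n%:R - 2^-1 - j%:R) ^+ 2 : rat)
  = (-1) ^+ l * (falling (n%:R - k%:R - 2^-1) l * falling (n%:R + k%:R - 2^-1) l).
Proof.
elim: l => [|l IHl]; first by rewrite /falling !big_ord0 !mulr1.
by rewrite big_ord_recr /= IHl !fallingS [in RHS]exprS; ring.
Qed.

Lemma boundary0E (n l : nat) : (l <= n)%N ->
  half_rising (2 * n) * boundary n l 0
  = falling ((2 * n)%:R - 2^-1) (2 * l)
    * (((2 * n)%:R - (2 * l)%:R - 1) / 2 * hbin (2 * n - 2 * l) (n - l)).
Proof.
move=> le_ln; rewrite /boundary /absorbed /hbin subn0 addn0 subr0.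
have -> : (2 * n - 2 * l - (n - l) = n - l)%N by lia.
rewrite !falling_half ?leq_mul2l // !natrM.
by field; rewrite !half_rising_neq0.
Qed.

(** At k = n the first falling factorial starts at -1/2, so it equals (-1)^l (1/2)_l; this produces
    the inverse of [hbin] and the sign (-1)^(n+l). *)
Lemma boundarynE (n l : nat) : (l <= n)%N ->
  half_rising (2 * n) * boundary n l n
  = - (falling ((2 * n)%:R - 2^-1) (2 * l)
       * ((-1) ^+ (n + l) * ((1 + 2 * n)%:R * (1 + 2 * l)%:R / 2)
          * (hbin (2 * n - l) l)^-1)).
Proof.
move=> le_ln; rewrite /boundary /absorbed /hbin subnn addnn -mul2n.
have -> : (2 * n - l - l = 2 * n - 2 * l)%N by lia.
have r0 : half_rising 0 = 1 by rewrite /rising big_ord0.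
rewrite r0 subrr sub0r falling_opp.
rewrite -natrD addnn -mul2n !falling_half ?leq_mul2l //; last by lia.
rewrite exprD (natrD _ 1 (2 * n)) (natrD _ 1 (2 * l)) !natrM.
by field; rewrite !half_rising_neq0.
Qed.

Theorem theorem12 (m n : nat) (m_gt0 : (0 < m)%N) (n_gt0 : (0 < n)%N)
    (n_gtm1 : (m + 1 < n)%N) :
  \sum_(1 <= k < n.+1)
     (-1) ^+ (k - 1) * hbin (2 * n) (n - k) * k%:R ^+ (1 + 2 * m)
  = 1 / 8 *
    \sum_(0 <= l < m.+1)
      (-1) ^+ l * falling ((2 * n)%:R - 1 / 2 : rat) (2 * l)
      * (((2 * n)%:R - (2 * l)%:R - 1) / (n%:R - l%:R - 1)
           * hbin (2 * n - 2 * l) (n - l)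
         + (-1) ^+ (n + l)
           * ((1 + 2 * n)%:R * (1 + 2 * l)%:R / (n%:R - l%:R - 1))
           * (hbin (2 * n - l) l)^-1)
      * sigma m l (n%:R - 1 / 2 : rat).
Proof.
rewrite !div1r mulr_sumr.
transitivity (\sum_(0 <= l < m.+1) (-1) ^+ l * half_rising (2 * n)
  * (\sum_(1 <= k < n.+1) (-1) ^+ (k - 1) * k%:R * absorbed n l k)
  * sigma m l (n%:R - 2^-1 : rat)).
  under [RHS]eq_bigr => l _ do rewrite mulr_sumr mulr_suml.
  rewrite exchange_big /=; apply: eq_big_nat => k /andP[_ lt_kn].
  pose c j : rat := (n%:R - 2^-1 - j%:R) ^+ 2.
  (* One factor k stays outside as the weight; only (k^2)^m is expanded. *)
  rewrite exprD expr1 exprM (newton_expansion c _ m) big_mkord mulrA mulr_sumr.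
  apply: eq_bigr => l _.
  rewrite prod_newton_nodes /hbin /absorbed /sigma.
  have -> : (2 * n - (n - k) = n + k)%N by lia.
  by rewrite -/(geom_prod c l.+1); ring.
apply: eq_big_nat => l /andP[_ lt_lm]; rewrite mulrA; congr (_ * _).
(* From l <= m and m + 1 < n, so the telescoped identity can be solved for the sum. *)
have N_neq0 : n%:R - l%:R - 1 != 0 :> rat.
  have -> : n%:R - l%:R - 1 = (n - l - 1)%:R :> rat by rewrite !natrB //; lia.
  by rewrite pnatr_eq0; lia.
have sumE := telescoping l (leqnn n).
set S := \sum_(_ <= _ < _) _ in sumE *.
have -> : S = (boundary n l 0 - boundary n l n) / (4 * (n%:R - l%:R - 1)).
  by rewrite -sumE mulrC mulKf // mulf_neq0.
transitivity ((-1) ^+ l * (half_rising (2 * n) * boundary n l 0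
    - half_rising (2 * n) * boundary n l n) / (4 * (n%:R - l%:R - 1))).
  by rewrite -mulrBr !mulrA.
(* The 1/8 is 1/4 from telescoping times the 1/2 in each boundary value. *)
rewrite boundary0E ?boundarynE; try lia.
by field; rewrite N_neq0 hbin_neq0.
Qed.
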